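(* Let $k\in\mathbb{N}$. Then $E^{(k)}_\bullet$ determines a subcomplex of $E_\bullet$. Consequently, the level filtration is a filtration of augmented chain complexes $$E^{(0)}_\bullet\hookrightarrow E^{(1)}_\bullet\hookrightarrow\cdots\hookrightarrow E^{(k)}_\bullet\hookrightarrow\cdots$$ whose colimit is $E_\bullet$.
   Context: Here $\mathbb{N}$ includes $0$, $\mathbb{F}_2=\{0,1\}$ is the field with two elements (''bits'') with addition $\oplus$, $(-)^m$ denotes $(-1)^m$, and $\mathbb{Z}B$ is the free abelian group on a set $B$. Noncrossing partitions. A partition of degree $n$ is a partition $\{\pi_1,\dots,\pi_k\}$ of $\{1,\dots,n\}$ into non-empty blocks; it is noncrossing if for all $i,j$, all $a,a'\in\pi_i$, $b,b'\in\pi_j$, $a<b<a'<b'$ implies $i=j$. The empty partition $\{\}$ is the only partition of degree $0$. For $i,m\in\mathbb{N}$ let $\mathsf{s}_i^m\colon\mathbb{N}\to\mathbb{N}$ send $x\mapsto x$ if $x<i$ and $x\mapsto x+m$ if $x\ge i$. For noncrossing partitions $p=\{\pi_1,\dots,\pi_k\}$ of degree $n$, $q=\{\rho_1,\dots,\rho_\ell\}$ of degree $m$, and $i\in\{1,\dots,n+1\}$, set $p\circ_i q=\{\mathsf{s}_i^m(\pi_1),\dots,\mathsf{s}_i^m(\pi_k),\mathsf{s}_1^{i-1}(\rho_1),\dots,\mathsf{s}_1^{i-1}(\rho_\ell)\}$, a noncrossing partition of degree $n+m$. Polarised noncrossing partitions. A polarised noncrossing partition of degree $n$ is a pair $(p,b_1\cdots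 b_{n+1})$ (also written $(p,b_\bullet)$) of a noncrossing partition $p$ of degree $n$ and a string of $n+1$ bits; their set is $\mathrm{NCP}_{\mathbb{F}_2}(n)$. For $(p,b_\bullet)$ of degree $n$, $(q,c_\bullet)$ of degree $m$, $i\in\{1,\dots,n+1\}$, set $(p,b_\bullet)\circ_i(q,c_\bullet)=(p\circ_i q,\ b_1\cdots b_{i-1}(b_i\oplus c_1)\cdots(b_i\oplus c_{m+1})b_{i+1}\cdots b_{n+1})$. For $b\in\{0,1\}$ let $\psi_0^b=(\{\},b)$, and for $n>0$ let $\psi_n^b=(\{\{1,\dots,n\}\},b0\cdots0)$. Rightmost decomposition. Every polarised noncrossing partition has a unique factorisation of the form $(\dots((\psi_0^0\circ_{i_1}\psi_{m_1}^{c_1})\circ_{i_2}\psi_{m_2}^{c_2})\dots)\circ_{i_k}\psi_{m_k}^{c_k}$ with $k\ge0$, $i_1<\dots<i_k$, and, for each $j$, $m_j>0$ or $c_j=1$; it is called its rightmost decomposition and $k$ its length. Those of length at most $1$ are exactly the $\psi_m^c$. The augmented chain complex $E_\bullet$. An augmented chain complex is a chain complex of abelian groups in non-negative degrees with differential $\mathrm{d}$ together with a homomorphism $\mathrm{e}$ from degree $0$ to $\mathbb{Z}$ such that $\mathrm{e}\mathrm{d}=0$; morphisms are degreewise homomorphisms of abelian groups commuting with the differentials and augmentations. Put $E_0=\mathbb{Z}\{s,t\}$, $E_{n+1}=\mathbb{Z}(\mathrm{NCP}_{\mathbb{F}_2}(n))$ for $n\in\mathbb{N}$, $\mathrm{e}s=\mathrm{e}t=1$.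 Define $\mathrm{d}$ on generators by induction on the length of the rightmost decomposition, extending $-\circ_i-$ bilinearly where necessary: $\mathrm{d}\psi_0^c=(-)^c(t-s)$; $\mathrm{d}\psi_{m+1}^c=\psi_m^{c\oplus1}+(-)^m\psi_m^c$. If the rightmost decomposition is $(p',b'_\bullet)\circ_i\psi_m^c$ with $\psi_m^c$ its final factor and $p'$ of degree $k>0$, then: - if $i=k+1$: $\mathrm{d}((p',b'_\bullet)\circ_i\psi_0^1)=-\mathrm{d}(p',b'_\bullet)$ and $\mathrm{d}((p',b'_\bullet)\circ_i\psi_{m+1}^c)=(p',b'_\bullet)\circ_i\mathrm{d}\psi_{m+1}^c$; - if $i<k+1$: $\mathrm{d}((p',b'_\bullet)\circ_i\psi_0^1)=\mathrm{d}(p',b'_\bullet)\circ_i\psi_0^1$ and $\mathrm{d}((p',b'_\bullet)\circ_i\psi_{m+1}^c)=\mathrm{d}(p',b'_\bullet)\circ_i\psi_{m+1}^c+(-)^{k+1-i}(p',b'_\bullet)\circ_i\mathrm{d}\psi_{m+1}^c$. This is a well-defined augmented chain complex. Level filtration. The level $\ell_{\mathrm{NCP}}(p)$ of a noncrossing partition $p$ of degree $n$ is $0$ if $n=0$, and otherwise the maximum over the blocks $\pi$ of $p$ of $\min\pi$. The level of a bit string is $\ell_{\mathrm{B}}(b_1\cdots b_n)=\max(\{i\mid b_i=1\}\cup\{0\})$. The level of a polarised noncrossing partition is $\ell(p,b_\bullet)=\max\{\ell_{\mathrm{NCP}}(p),\ell_{\mathrm{B}}(b_\bullet)\}$. For $k\in\mathbb{N}$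 let $E^{(k)}_0=E_0$ and $E^{(k)}_{n+1}=\mathbb{Z}\{(p,b_\bullet)\in\mathrm{NCP}_{\mathbb{F}_2}(n)\mid\ell(p,b_\bullet)\le k\}$ for $n\in\mathbb{N}$, regarded as a subgroup of $E_{n+1}$. The level filtration is the resulting chain, in each degree $n$, of inclusions of abelian groups $E^{(0)}_n\hookrightarrow E^{(1)}_n\hookrightarrow\cdots\hookrightarrow E^{(k)}_n\hookrightarrow\cdots$. *)

(* Defs.v *)
From HB Require Import structures.
From mathcomp Require Import all_boot.
From mathcomp Require Import order ssralg ssrnum ssrint.
From mathcomp Require Import finmap.
From mathcomp Require Import freeg zify.

Set Implicit Arguments.
Unset Strict Implicit.
Unset Printing Implicit Defensive.

Import GRing.Theory.

Local Open Scope fset_scope.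
Local Open Scope nat_scope.

Definition is_partition (n : nat) (p : {fset {fset nat}}) : bool :=
  [&& fset0 \notin p, trivIfset p & fcover p == [fset x in iota 1 n]].

Definition noncrossing (p : {fset {fset nat}}) : bool :=
  [forall A : p, forall B : p,
   forall a : val A, forall a' : val A, forall b : val B, forall b' : val B,
   [&& val a < val b, val b < val a' & val a' < val b'] ==> (A == B)].

Definition is_ncp (n : nat) (p : {fset {fset nat}}) : bool :=
  is_partition n p && noncrossing p.

Definition shift (i m x : nat) : nat := if x < i then x else x + m.

Definition ncp_comp (p : {fset {fset nat}}) (i m : nat) (q : {fset {fset nat}}) :
    {fset {fset nat}} :=
  [fset [fset shift i m x | x in A : {fset nat}] | A in p] `|`
  [fset [fset shift 1 i.-1 x | x in B : {fset nat}] | B in q].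

(* Underlying data of a polarised noncrossing partition, of unspecified degree:
   keeping the degree out of the type lets [pcomp] avoid casts along n + m.
   Bits are booleans, and addition in F_2 is (+) = addb. *)
Definition pol : Type := ({fset {fset nat}} * seq bool)%type.
HB.instance Definition _ := Choice.on pol.

Definition pdeg (x : pol) : nat := (size x.2).-1.

Definition is_pncp (n : nat) (x : pol) : bool :=
  is_ncp n x.1 && (size x.2 == n.+1).

Record NCP_F2 (n : nat) := NCP_F2_of { pncp_val :> pol; _ : is_pncp n pncp_val }.
HB.instance Definition _ n := [isSub for @pncp_val n].
HB.instance Definition _ n := [Choice of NCP_F2 n by <:].

Definition pcomp (x : pol) (i : nat) (y : pol) : pol :=
  (ncp_comp x.1 i (pdeg y) y.1,
   take i.-1 x.2 ++ [seq nth false x.2 i.-1 (+) c | c <- y.2] ++ drop i x.2).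

Definition psi (n : nat) (b : bool) : pol :=
  (if n is 0 then fset0 else [fset [fset x in iota 1 n]], b :: nseq n false).

(* (i, m, c) stands for the operation - o_i psi_m^c. *)
Definition factor : Type := (nat * nat * bool)%type.

(* A factorisation is stored with its final factor at the head of the list; all
   of them start from psi_0^0. *)
Fixpoint compose (w : seq factor) : pol :=
  if w is (i, m, c) :: w' then pcomp (compose w') i (psi m c) else psi 0 false.

Definition last_index (w : seq factor) : nat :=
  if w is (i, _, _) :: _ then i else 0.

Fixpoint rightmost (w : seq factor) : bool :=
  if w is (i, m, c) :: w' then
    [&& rightmost w', last_index w' < i, i <= (pdeg (compose w')).+1
      & (0 < m) || c]
  else true.

(* The minimum of A, for A nonempty. *)
Definition fmin (A : {fset nat}) : nat := head 0 (sort leq A).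
Definition ncp_level (p : {fset {fset nat}}) : nat := \max_(A <- p) fmin A.
Definition bits_level (b : seq bool) : nat :=
  \max_(i < size b | nth false b i) i.+1.
Definition level (x : pol) : nat := maxn (ncp_level x.1) (bits_level x.2).


Lemma in_segment m x : (x \in [fset y in iota 1 m]) = (0 < x <= m).
Proof. by rewrite in_fset /= -(mem_iota 1 m) /=. Qed.

Lemma is_ncpP n p : reflect
  [/\ forall A, A \in p -> A != fset0,
      forall A B x, A \in p -> B \in p -> x \in A -> x \in B -> A = B,
      forall x, (exists2 A : {fset nat}, A \in p & x \in A) <-> 0 < x <= n
    & forall A B a a' b b', A \in p -> B \in p -> a \in A -> a' \in A ->
        b \in B -> b' \in B -> a < b -> b < a' -> a' < b' -> A = B]
  (is_ncp n p).
Proof.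
apply: (iffP idP).
  case/andP=> /and3P[p0 /trivIfsetP pI /eqP pc] /forallP pn; split.
  - by move=> A Ap; apply: contraNneq p0 => <-.
  - move=> A B x Ap Bp xA xB; apply/eqP; apply/negPn/negP => /(pI A B Ap Bp).
    by move/fdisjointP/(_ x xA); rewrite xB.
  - move=> x; move/fsetP/(_ x): pc; rewrite in_segment.
    move=> <-; split => [[A Ap xA]|].
      by apply/bigfcupP; exists A; rewrite ?Ap.
    by case/bigfcupP=> A; rewrite andbT => Ap xA; exists A.
  - move=> A B a a' b b' Ap Bp aA a'A bB b'B ab ba' a'b'.
    have /forallP/(_ [` Bp])/forallP/(_ [` aA])/forallP/(_ [` a'A])/forallP/(_ [` bB])/forallP/(_ [` b'B])/implyP /= := pn [` Ap].
    by rewrite ab ba' a'b' => /(_ isT)/eqP/(congr1 val).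
case=> p0 pI pc pn; apply/andP; split.
  apply/and3P; split.
  - by apply/negP => /p0; rewrite eqxx.
  - apply/trivIfsetP => A B Ap Bp /eqP AB; apply/fdisjointP => x xA.
    by apply/negP => xB; apply: AB; apply: pI xA xB.
  - apply/eqP/fsetP => x; rewrite in_segment.
    apply/bigfcupP/idP => [[A]|/pc[A Ap xA]]; last by exists A; rewrite ?Ap.
    by rewrite andbT => Ap xA; apply/pc; exists A.
apply/forallP=> A; apply/forallP=> B; apply/forallP=> a; apply/forallP=> a'.
apply/forallP=> b; apply/forallP=> b'; apply/implyP=> /and3P[ab ba' a'b'].
apply/eqP/val_inj => /=.
exact: (pn _ _ _ _ _ _ (valP A) (valP B) (valP a) (valP a') (valP b) (valP b')).
Qed.

Lemma shift_inj i m : injective (shift i m).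
Proof. by move=> x y; rewrite /shift; case: ifP; case: ifP; lia. Qed.

Lemma shift_lt i m x y : (shift i m x < shift i m y) = (x < y).
Proof. by rewrite /shift; case: ifP; case: ifP; lia. Qed.

Lemma shift_imfset_inj i m :
  injective (fun A : {fset nat} => [fset shift i m x | x in A]).
Proof.
move=> A B /fsetP AB; apply/fsetP => x.
by move: (AB (shift i m x)); rewrite !mem_imfset //; exact: shift_inj.
Qed.

Lemma ncp_compP (p : {fset {fset nat}}) i m (q : {fset {fset nat}}) (C : {fset nat}) : reflect
  ((exists2 A, A \in p & C = [fset shift i m x | x in A]) \/
   (exists2 B, B \in q & C = [fset shift 1 i.-1 x | x in B]))
  (C \in ncp_comp p i m q).
Proof.
rewrite in_fsetU; apply: (iffP orP).
  by case=> /imfsetP[A /= Ap ->]; [left|right]; exists A.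
by case=> -[A Ap ->]; [left|right]; apply/imfsetP; exists A.
Qed.

Lemma ncp_comp_ncp n m p q i : 0 < i <= n.+1 -> is_ncp n p -> is_ncp m q ->
  is_ncp (n + m) (ncp_comp p i m q).
Proof.
move=> iB /is_ncpP[p0 pI pc pn] /is_ncpP[q0 qI qc qn].
have sp A x : A \in p -> x \in A -> 0 < x <= n by move=> Ap xA; apply/pc; exists A.
have sq A x : A \in q -> x \in A -> 0 < x <= m by move=> Ap xA; apply/qc; exists A.
apply/is_ncpP; split.
- move=> C /ncp_compP[] [A AP ->].
    have /fset0Pn[x xA] := p0 _ AP; apply/fset0Pn.
    by exists (shift i m x); apply: in_imfset.
  have /fset0Pn[x xA] := q0 _ AP; apply/fset0Pn.
  by exists (shift 1 i.-1 x); apply: in_imfset.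
- move=> C D x /ncp_compP[] [A AP ->] /ncp_compP[] [B BP ->] /imfsetP[a /= aA ->] /imfsetP[b /= bB].
  + by move/shift_inj => ab; rewrite (pI A B a) // ab.
  + have := sp _ _ AP aA; have := sq _ _ BP bB; rewrite /shift; case: ifP; case: ifP; lia.
  + have := sq _ _ AP aA; have := sp _ _ BP bB; rewrite /shift; case: ifP; case: ifP; lia.
  + by move/shift_inj => ab; rewrite (qI A B a) // ab.
- move=> x; split.
    case=> C /ncp_compP[] [A AP ->] /imfsetP[a /= aA ->].
    + have := sp _ _ AP aA; rewrite /shift; case: ifP; lia.
    + have := sq _ _ AP aA; rewrite /shift; case: ifP; lia.
  move=> xB; have [xi|xi] := ltnP x i.
    have /pc[A Ap xA] : 0 < x <= n by lia.
    exists [fset shift i m x | x in A]; first by apply/ncp_compP; left; exists A.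
    by apply/imfsetP; exists x => //=; rewrite /shift xi.
  have [xm|xm] := ltnP x (i + m).
    have /qc[A Ap xA] : 0 < x - i.-1 <= m by lia.
    exists [fset shift 1 i.-1 x | x in A]; first by apply/ncp_compP; right; exists A.
    apply/imfsetP; exists (x - i.-1) => //=; rewrite /shift; case: ifP; lia.
  have /pc[A Ap xA] : 0 < x - m <= n by lia.
  exists [fset shift i m x | x in A]; first by apply/ncp_compP; left; exists A.
  apply/imfsetP; exists (x - m) => //=; rewrite /shift; case: ifP; lia.
- move=> C D a a' b b' /ncp_compP[] [A AP ->] /ncp_compP[] [B BP ->]
   /imfsetP[{}a /= aA ->] /imfsetP[{}a' /= a'A ->]
   /imfsetP[{}b /= bB ->] /imfsetP[{}b' /= b'B ->].
  + by rewrite !shift_lt => ? ? ?; rewrite (pn A B a a' b b').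
  + have := sp _ _ AP aA; have := sp _ _ AP a'A;  have := sq _ _ BP bB; have := sq _ _ BP b'B.
    rewrite /shift; do !case: ifP; lia.
  + have := sq _ _ AP aA; have := sq _ _ AP a'A;  have := sp _ _ BP bB; have := sp _ _ BP b'B.
    rewrite /shift; do !case: ifP; lia.
  + by rewrite !shift_lt => ? ? ?; rewrite (qn A B a a' b b').
Qed.

Lemma ncp0 : is_ncp 0 fset0.
Proof.
apply/is_ncpP; split => [A|A B x|x|A B ? ? ? ?]; rewrite ?in_fset0 //.
by split=> [[A]|]; rewrite ?in_fset0 //; lia.
Qed.

Lemma ncp1 n : is_ncp n.+1 [fset [fset x in iota 1 n.+1]].
Proof.
apply/is_ncpP; split=> [A /fset1P ->|A B x /fset1P -> /fset1P ->|x|A B a a' b b' /fset1P -> /fset1P ->] //.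
  by apply/fset0Pn; exists 1; rewrite in_segment; lia.
split=> [[A /fset1P ->]|xB]; first by rewrite in_segment; lia.
exists [fset x in iota 1 n.+1]; first exact/fset1P.
by rewrite in_segment; lia.
Qed.

Lemma psi_pncp n b : is_pncp n (psi n b).
Proof.
rewrite /is_pncp /= size_nseq eqxx andbT.
by case: n => [|n]; [apply: ncp0|apply: ncp1].
Qed.

Lemma pncp_pdeg n x : is_pncp n x -> pdeg x = n.
Proof. by case/andP=> _ /eqP; rewrite /pdeg => ->. Qed.

Lemma pncp_size n x : is_pncp n x -> size x.2 = n.+1.
Proof. by case/andP=> _ /eqP. Qed.

Lemma pcomp_pncp n m x i y : 0 < i <= n.+1 -> is_pncp n x -> is_pncp m y ->
  is_pncp (n + m) (pcomp x i y).
Proof.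
move=> iB px py; rewrite /is_pncp /= (pncp_pdeg py).
case/andP: px => px /eqP sx; case/andP: py => py /eqP sy.
rewrite ncp_comp_ncp //= !size_cat size_map size_take size_drop sx sy.
by case: ltnP; lia.
Qed.

Lemma psi0_r x i : 0 < i <= size x.2 -> pcomp x i (psi 0 false) = x.
Proof.
case: x => p b /= /andP[i0 ib]; rewrite /pcomp /pdeg /=; congr (_, _).
  apply/fsetP => C; apply/ncp_compP/idP.
    have sA (A : {fset nat}) : [fset shift i 0 x | x in A] = A.
      apply/fsetP => x; apply/imfsetP/idP => [[y /= yA ->]|xA].
        by rewrite /shift addn0 if_same.
      by exists x; rewrite //= /shift addn0 if_same.
    by case=> -[A Ap ->]; rewrite ?sA // in_fset0 in Ap *.
  move=> Cp; left; exists C => //; apply/fsetP => x.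
  apply/idP/imfsetP => [xC|[y /= yC ->]]; last by rewrite /shift addn0 if_same.
  by exists x; rewrite //= /shift addn0 if_same.
case: i i0 ib => // i _ ib /=.
by rewrite addbF -drop_nth // cat_take_drop.
Qed.

Lemma fmin_in (A : {fset nat}) : A != fset0 -> fmin A \in A.
Proof.
move=> /fset0Pn[x xA]; rewrite /fmin.
have := mem_sort leq A; case: (sort leq A) => [/(_ x)|y s /(_ y)] /=.
  by rewrite xA.
by rewrite in_cons eqxx => <-.
Qed.

Lemma fmin_le (A : {fset nat}) x : x \in A -> fmin A <= x.
Proof.
rewrite /fmin -(mem_sort leq A); have := sort_sorted leq_total A.
case: (sort leq A) => //= y s /(order_path_min leq_trans)/allP ys.
by rewrite in_cons => /predU1P[->//|/ys].
Qed.

Lemma ncp_level_leP (p : {fset {fset nat}}) j :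
  reflect (forall A, A \in p -> fmin A <= j) (ncp_level p <= j).
Proof.
apply: (iffP (bigmax_leqP_seq _ _ _ _)) => [H A Ap|H A Ap _]; last exact: H.
exact: H.
Qed.

Lemma bits_level_leP b j :
  reflect (forall i, nth false b i -> i < j) (bits_level b <= j).
Proof.
rewrite /bits_level; apply: (iffP (@bigmax_leqP _ _ _ _)) => [H i bi|H i bi]; last exact: H.
have ib : i < size b by rewrite ltnNge; apply/negP => ?; rewrite nth_default in bi.
exact: (H (Ordinal ib)).
Qed.

Lemma level_leP x j : reflect
  ((forall A, A \in x.1 -> fmin A <= j) /\ (forall i, nth false x.2 i -> i < j))
  (level x <= j).
Proof.
rewrite /level geq_max; apply: (iffP andP) => -[].
  by move=> /ncp_level_leP ? /bits_level_leP.
by move=> ? ?; split; [apply/ncp_level_leP|apply/bits_level_leP].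
Qed.

Lemma nth_pcomp x i m c j : level x < i <= size x.2 ->
  nth false (pcomp x i (psi m c)).2 j =
  if j < i.-1 then nth false x.2 j else (j == i.-1) && c.
Proof.
case: x => p b /andP[]; case: i => // i /= /level_leP[_ /= bl] ib.
have b0 k : i <= k -> nth false b k = false.
  by move=> ik; apply/negP => /bl; lia.
rewrite nth_cat size_take ib; case: ifP => ji; first by rewrite nth_take.
rewrite b0 //=; case ij: (j - i) => [|k] /=.
  by have -> : j == i by lia.
have -> : j == i = false by lia.
rewrite nth_cat size_map size_nseq; case: ifP => kj.
  by rewrite (nth_map false) ?size_nseq // nth_nseq kj.
by rewrite nth_drop b0 //; lia.
Qed.

Lemma psi_blockP m c A : reflect (0 < m /\ A = [fset x in iota 1 m]) (A \in (psi m c).1).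
Proof.
case: m => [|m]; first by rewrite in_fset0; constructor => -[].
by apply: (iffP (fset1P _ _)) => [->|[]].
Qed.

Lemma in_shifted_segment i m x : 0 < i ->
  (x \in [fset shift 1 i.-1 y | y in [fset y in iota 1 m]]) = (i <= x < i + m).
Proof.
move=> i0; apply/imfsetP/idP => [[y /=]|xi].
  by rewrite in_segment /shift => ? ->; case: ifP; lia.
by exists (x - i.-1); rewrite /= ?in_segment /shift; [lia|case: ifP; lia].
Qed.

Lemma fmin_shift n p i m A : is_ncp n p -> ncp_level p < i -> A \in p ->
  fmin A < i /\ fmin A \in [fset shift i m x | x in A].
Proof.
case: i => // i /is_ncpP[p0 _ _ _] /ncp_level_leP pl Ap.
have Ai := pl _ Ap; split => //; apply/imfsetP; exists (fmin A).
  exact/fmin_in/p0.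
by rewrite /shift ltnS Ai.
Qed.

Lemma level_pcomp n x i m c : is_pncp n x -> level x < i <= n.+1 ->
  (0 < m) || c -> level (pcomp x i (psi m c)) = i.
Proof.
move=> px /andP[xi iB] mc.
have i0 : 0 < i by lia.
have sx := pncp_size px.
have nthE j : nth false (pcomp x i (psi m c)).2 j =
    if j < i.-1 then nth false x.2 j else (j == i.-1) && c.
  by apply: nth_pcomp; rewrite xi sx.
have ncpx : is_ncp n x.1 by case/andP: px.
have xi1 : ncp_level x.1 < i by move: xi; rewrite /level; lia.
apply/eqP; rewrite eqn_leq; apply/andP; split.
  apply/level_leP; split.
    move=> C /ncp_compP[] [A AP ->].
      have [Ai /fmin_le] := fmin_shift (pdeg (psi m c)) ncpx xi1 AP; lia.
    case/psi_blockP: AP => m0 ->; apply: fmin_le.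
    by rewrite in_shifted_segment //; lia.
  move=> j; rewrite nthE; case: ifP; first lia.
  by move=> _ /andP[/eqP -> _]; lia.
case: (posnP m) mc => [m0 /= c1|m0 _].
  have := leqnn (level (pcomp x i (psi m c))) => /level_leP[_ /(_ i.-1)].
  by rewrite nthE ltnn eqxx c1 => /(_ isT); lia.
have := leqnn (level (pcomp x i (psi m c))) => /level_leP[+ _].
set S := [fset shift 1 i.-1 y | y in [fset y in iota 1 m]].
move=> /(_ S) SC; apply: leq_trans (SC _).
  have : fmin S \in S.
    apply: fmin_in; apply/fset0Pn; exists i.
    by rewrite in_shifted_segment //; lia.
  by rewrite in_shifted_segment //; case/andP.
by apply/ncp_compP; right; exists [fset y in iota 1 m] => //; apply/psi_blockP.
Qed.

Lemma compose_level w : rightmost w ->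
  is_pncp (pdeg (compose w)) (compose w) /\ level (compose w) = last_index w.
Proof.
elim: w => [_|[[i m] c] w IH] /=.
  split; first exact: (psi_pncp 0 false).
  apply/eqP; rewrite -leqn0; apply/level_leP; split=> [A|[|[]]] //=.
case/and4P=> /IH[pw lw] wi iw mc; split.
  have pc := pcomp_pncp _ pw (psi_pncp m c).
  by rewrite (pncp_pdeg (pc i _)) ?pc //; lia.
by apply: (level_pcomp pw) => //; rewrite lw wi.
Qed.

Lemma peel_m n k x y i m l c e : is_pncp n x -> is_pncp k y ->
  level x < i <= n.+1 -> level y < i <= k.+1 ->
  pcomp x i (psi m c) = pcomp y i (psi l e) -> 0 < m -> m = l.
Proof.
move=> px py xi yi E m0; have i0 : 0 < i by lia.
set S := [fset shift 1 i.-1 y | y in [fset y in iota 1 m]].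
have : S \in (pcomp x i (psi m c)).1.
  by apply/ncp_compP; right; exists [fset y in iota 1 m] => //; apply/psi_blockP.
have SE z : z \in S = (i <= z < i + m) by exact: in_shifted_segment.
rewrite E => /ncp_compP[] [A AP SA].
  have ncpy : is_ncp k y.1 by case/andP: py.
  have yi1 : ncp_level y.1 < i by move: yi; rewrite /level; lia.
  have [] := fmin_shift (pdeg (psi l e)) ncpy yi1 AP.
  by move=> Ai; rewrite -SA => h; have := SE (fmin A); rewrite h; lia.
case/psi_blockP: AP SA => l0 -> /fsetP SA.
have := SA (i + m.-1); have := SA (i + l.-1).
by rewrite !in_shifted_segment //; lia.
Qed.

Lemma peel_sub n x y i m c e : is_pncp n x -> 0 < i ->
  pcomp x i (psi m c) = pcomp y i (psi m e) ->
  forall A, A \in x.1 -> A \in y.1.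
Proof.
move=> px i0 E A Ax.
have : [fset shift i m z | z in A] \in (pcomp x i (psi m c)).1.
  by apply/ncp_compP; left; exists A; rewrite // (pncp_pdeg (psi_pncp m c)).
rewrite E => /ncp_compP[] [B BP].
  by rewrite (pncp_pdeg (psi_pncp m e)) => /shift_imfset_inj ->.
case/psi_blockP: BP => m0 -> /fsetP/(_ i).
rewrite in_shifted_segment //; have -> : i <= i < i + m by lia.
by case/imfsetP=> z _; rewrite /shift; case: ifP; lia.
Qed.

Lemma peel n k x y i m l c e : is_pncp n x -> is_pncp k y ->
  level x < i <= n.+1 -> level y < i <= k.+1 ->
  pcomp x i (psi m c) = pcomp y i (psi l e) -> [/\ m = l, c = e & x = y].
Proof.
move=> px py xi yi E; have i0 : 0 < i by lia.
have ml : m = l.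
  case: (posnP m) (peel_m px py xi yi E) => [m0 _|m0 /(_ isT)//].
  case: (posnP l) (peel_m py px yi xi (esym E)) => [|l0 /(_ isT)//]; lia.
have sx := pncp_size px; have sy := pncp_size py.
have xi' : level x < i <= size x.2 by rewrite sx.
have yi' : level y < i <= size y.2 by rewrite sy.
have Xn j := nth_pcomp m c j xi'; have Yn j := nth_pcomp l e j yi'.
have ce : c = e by have := Xn i.-1; rewrite E Yn ltnn eqxx.
split=> //; clear xi' yi'; case: x y px py xi yi E sx sy Xn Yn => p b [q d] px py xi yi E sx sy Xn Yn.
rewrite -ml -ce in E; congr (_, _).
  apply/fsetP => A; apply/idP/idP; first exact: (peel_sub px i0 E).
  exact: (peel_sub py i0 (esym E)).
have nk : n = k.
  have iB : 0 < i <= n.+1 by lia.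
  have iB' : 0 < i <= k.+1 by lia.
  have := pncp_pdeg (pcomp_pncp iB px (psi_pncp m c)).
  have := pncp_pdeg (pcomp_pncp iB' py (psi_pncp m c)).
  by rewrite E; lia.
apply: (@eq_from_nth _ false); first by move: sx sy => /= -> ->; rewrite nk.
move=> j _; have [ji|ji] := ltnP j i.-1.
  by have := Xn j; have := Yn j; rewrite -ml -ce -E ji => -> /= ->.
have Z u s : level (u, s) < i -> nth false s j = false.
  case: (i) ji => // i' ji /level_leP[_ /(_ j) /= sj].
  by apply/negP => /sj; lia.
by rewrite (Z p) ?(Z q) //; [case/andP: yi|case/andP: xi].
Qed.

Lemma compose_inj w v : rightmost w -> rightmost v -> compose w = compose v -> w = v.
Proof.
elim: w v => [|[[i m] c] w IH] [|[[j l] e] v] // rw rv E.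
- have := (compose_level rv).2; rewrite -E (compose_level rw).2 /= => j0.
  by move: rv => /=; rewrite -j0 ltn0 andbF.
- have := (compose_level rw).2; rewrite E (compose_level rv).2 /= => j0.
  by move: rw => /=; rewrite -j0 ltn0 andbF.
have ij : i = j by have := (compose_level rw).2; rewrite E (compose_level rv).2.
subst j; move: rw rv E => /= /and4P[rw wi iw _] /and4P[rv vi iv _] E.
have [pw lw] := compose_level rw; have [pv lv] := compose_level rv.
have [] := peel pw pv _ _ E; rewrite ?lw ?lv ?wi ?vi //.
by move=> -> -> /(IH v rw rv) ->.
Qed.

Lemma strip n x : is_pncp n x -> 0 < level x ->
  exists m c y, [/\ m <= n, is_pncp (n - m) y, level y < level x,
    level x <= (n - m).+1 & (0 < m) || c] /\ x = pcomp y (level x) (psi m c).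
Proof.
case: x => p b px; set i := level (p, b) => i0.
have sb : size b = n.+1 := pncp_size px.
have pp : is_ncp n p by case/andP: px.
have /level_leP[/= pl bl] := leqnn (level (p, b)); rewrite -/i in pl bl.
have /is_ncpP[p0 pI pc pn] := pp.
have pB A z : A \in p -> z \in A -> 0 < z <= n by move=> Ap zA; apply/pc; exists A.
pose b' m := take i.-1 b ++ false :: drop (i + m) b.
have iin : i <= n.+1.
  rewrite /i /level geq_max; apply/andP; split.
    apply/ncp_level_leP => A Ap; have := pB _ _ Ap (fmin_in (p0 _ Ap)); lia.
  apply/bits_level_leP => j bj; rewrite -sb ltnNge.
  by apply/negP => jb; rewrite nth_default in bj.
have sb' m : i + m <= n.+1 -> size (b' m) = (n - m).+1.
  by move=> imn; rewrite size_cat size_take /= size_drop sb; case: ifP; lia.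
have nth_b' m j : nth false (b' m) j = if j < i.-1 then nth false b j else false.
  rewrite nth_cat size_take sb; have -> : i.-1 < n.+1 by lia.
  case: ifP => ji; first by rewrite nth_take.
  case: (j - i.-1) => //= k; rewrite nth_drop; apply/negP => /bl; lia.
have bE m c y : i + m <= n.+1 -> c = nth false b i.-1 -> y.2 = b' m -> level y < i ->
    b = (pcomp y i (psi m c)).2.
  move=> imn cE yE yi; apply: (@eq_from_nth _ false).
    rewrite /= size_cat /= size_cat size_map size_nseq size_take size_drop yE sb' // sb.
    by case: ifP; lia.
  move=> j _; rewrite nth_pcomp; last by rewrite yi yE sb' //; lia.
  rewrite yE nth_b'; case: ifP => [->//|ji]; case: (eqVneq j i.-1) => [->|/eqP jni] /=; first by rewrite -cE.
  by apply/negP => /bl; lia.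
have [/hasP[/= P Pp /eqP Pi]|/hasPn nP] := boolP (has (fun A => fmin A == i) p); last first.
  have bi : nth false b i.-1.
    apply/negPn/negP => bi.
    suff : i <= i.-1 by lia.
    apply/level_leP; split=> [A Ap|j bj] /=.
      by have := pl A Ap; have /eqP := nP A Ap; lia.
    by have := bl j bj; case: (eqVneq j i.-1) => [ji|/eqP]; [rewrite ji (negbTE bi) in bj|lia].
  exists 0, true, (p, b' 0); rewrite subn0.
  have yl : level (p, b' 0) < i.
    rewrite -[i in _ < i]prednK // ltnS; apply/level_leP; split=> [A Ap|j] /=.
      by have := pl A Ap; have /eqP := nP A Ap; lia.
    by rewrite nth_b'; case: ifP.
  split; first split => //.
    by rewrite /is_pncp /= pp sb' ?addn0 ?subn0 ?eqxx.
  rewrite [LHS]surjective_pairing [RHS]surjective_pairing; congr (_, _); last first.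
    by apply: bE => //; rewrite addn0.
  have sz : 0 < i <= size (p, b' 0).2 by rewrite /= sb' ?addn0 //; lia.
  by have /(congr1 fst) := psi0_r sz.
pose M := \max_(x <- P) x; pose m := M.+1 - i.
have P0 := p0 _ Pp.
have iP : i \in P by rewrite -Pi fmin_in.
have Pge z : z \in P -> i <= z by move/fmin_le; rewrite Pi.
have PM z : z \in P -> z <= M by move=> zP; rewrite /M (big_fsetD1 z) //= leq_maxl.
have MP : M \in P.
  have P1 : 0 < #|{: P}| by apply/card_gt0P; exists [` iP].
  have [z zE] := eq_bigmax (fun z : P => val z) P1.
  have <- : val z = M by rewrite /M -zE big_seq_fsetE.
  exact: valP.
have iM : i <= M := Pge _ MP.
have PE z : z \in P = (i <= z < i + m).
  apply/idP/idP => [zP|zi]; first by have := Pge z zP; have := PM z zP; rewrite /m; lia.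
  have Mn := pB _ _ Pp MP.
  have [<-//|/eqP zi'] := eqVneq i z; have [->//|/eqP zM] := eqVneq z M.
  have /pc[B Bp zB] : 0 < z <= n by move: zi; rewrite /m; lia.
  have Bi := pl _ Bp; have Bin := fmin_in (p0 _ Bp).
  have [Bii|/eqP Bii] := eqVneq (fmin B) i; first by rewrite (pI P B i) // -Bii.
  by rewrite -(pn B P (fmin B) z i M) //; move: zi; rewrite /m; lia.
have m0 : 0 < m by rewrite /m; lia.
have imn : i + m <= n.+1 by have := pB _ _ Pp MP; rewrite /m; lia.
pose u z := if z < i then z else z - m.
have out A z : A \in p `\ P -> z \in A -> (z < i) || (i + m <= z).
  case/fsetD1P => /eqP AP Ap zA; have := PE z.
  have [zP _|_] := boolP (z \in P); last lia.
  by case: AP; apply: pI zA zP.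
have uK A z : A \in p `\ P -> z \in A -> shift i m (u z) = z.
  by move=> AP /(out A z AP); rewrite /u /shift; do !case: ifP; lia.
have uKs A : A \in p `\ P -> [fset shift i m y | y in [fset u z | z in A]] = A.
  move=> AP; apply/fsetP => z; apply/imfsetP/idP => [[y /= /imfsetP[v /= vA ->] ->]|zA].
    by rewrite (uK A).
  by exists (u z); rewrite /= ?(uK A) //; apply/imfsetP; exists z.
have ul A B y z : A \in p `\ P -> B \in p `\ P -> y \in A -> z \in B ->
    (u y < u z) = (y < z).
  move=> AP BP yA zB; have := out _ _ AP yA; have := out _ _ BP zB.
  by rewrite /u; do !case: ifP; lia.
pose p' := [fset [fset u z | z in A : {fset nat}] | A in p `\ P].
have p'P C : reflect (exists2 A, A \in p `\ P & C = [fset u z | z in A]) (C \in p').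
  by apply: (iffP (imfsetP _ _ _ _)) => -[A /= AP ->]; exists A.
have DP A : A \in p `\ P -> A \in p by case/fsetD1P.
have pp' : is_ncp (n - m) p'.
  apply/is_ncpP; split.
  - move=> C /p'P[A AP ->]; have /fset0Pn[z zA] := p0 _ (DP _ AP).
    by apply/fset0Pn; exists (u z); apply/imfsetP; exists z.
  - move=> C D z /p'P[A AP ->] /p'P[B BP ->] /imfsetP[y /= yA ->] /imfsetP[v /= vB uE].
    have yv : y = v by rewrite -(uK A y) // uE (uK B).
    by rewrite (pI A B y) ?DP // yv.
  - move=> z; split=> [[C /p'P[A AP ->] /imfsetP[y /= yA ->]]|zn].
      have := pB _ _ (DP _ AP) yA; have := out _ _ AP yA; rewrite /u; case: ifP; lia.
    have /pc[A Ap zA] : 0 < shift i m z <= n by rewrite /shift; case: ifP; lia.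
    have AP : A \in p `\ P.
      apply/fsetD1P; split=> //; apply/eqP => AE; move: zA.
      by rewrite AE PE /shift; case: ifP; lia.
    exists [fset u y | y in A]; first by apply/p'P; exists A.
    apply/imfsetP; exists (shift i m z) => //=.
    by rewrite /shift /u; do !case: ifP; lia.
  - move=> C D a a' d d' /p'P[A AP ->] /p'P[B BP ->] /imfsetP[{}a /= aA ->]
      /imfsetP[{}a' /= a'A ->] /imfsetP[{}d /= dB ->] /imfsetP[{}d' /= d'B ->].
    rewrite (ul A B) // (ul B A) // (ul A B) // => ? ? ?.
    by rewrite (pn A B a a' d d') ?DP.
have yl : level (p', b' m) < i.
  rewrite -[i in _ < i]prednK // ltnS; apply/level_leP; split=> [C /p'P[A AP ->]|j] /=.
    have Ap := DP _ AP; have Am := fmin_in (p0 _ Ap).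
    have Ai : fmin A < i by have := pl _ Ap; have := out _ _ AP Am; lia.
    apply: (@leq_trans (fmin A)); last lia.
    by apply: fmin_le; apply/imfsetP; exists (fmin A); rewrite //= /u Ai.
  by rewrite nth_b'; case: ifP.
exists m, (nth false b i.-1), (p', b' m); rewrite m0; split.
  split => //; [lia| |lia].
  by rewrite /is_pncp /= pp' sb' ?eqxx.
rewrite [LHS]surjective_pairing [RHS]surjective_pairing; congr (_, _); last exact: bE.
apply/fsetP => C; rewrite /pcomp [pdeg _](pncp_pdeg (psi_pncp m _)) /=.
have PE' : P = [fset shift 1 i.-1 y | y in [fset y in iota 1 m]].
  by apply/fsetP => z; rewrite in_shifted_segment // PE.
apply/idP/ncp_compP => [Cp|].
  have [CP|CP] := eqVneq C P.
    right; exists [fset y in iota 1 m]; rewrite ?CP //.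
    by apply/(psi_blockP m false).
  have CD : C \in p `\ P by apply/fsetD1P.
  left; exists [fset u z | z in C]; last by rewrite uKs.
  by apply/p'P; exists C.
case=> -[A].
  by move=> /p'P[B BP ->] ->; rewrite uKs // DP.
by move/(psi_blockP m false) => -[_ ->] ->; rewrite -PE'.
Qed.

Lemma rightmost_exists n x : is_pncp n x ->
  exists w, rightmost w && (compose w == x).
Proof.
have [j] := ubnP (level x); elim: j n x => // j IH n x /ltnSE lj px.
have [l0|/(strip px)[m [c [y [[mn py yx xn mc] xE]]]]] := posnP (level x).
  exists [::]; rewrite /=; move: px l0; case: x {lj} => p b px l0.
  have /level_leP[/= pl bl] := eq_leq l0.
  have sb : size b = n.+1 := pncp_size px.
  have /is_ncpP[p0 pI pc pn] : is_ncp n p by case/andP: px.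
  have p0' : p = fset0.
    apply/eqP; apply/negPn/negP => /fset0Pn[A Ap].
    have Am := fmin_in (p0 _ Ap); have := pl _ Ap.
    suff : 0 < fmin A <= n by lia.
    by apply/pc; exists A.
  have n0 : n = 0.
    case: n pc {px sb pn} => // n pc; have /pc[A] : 0 < 1 <= n.+1 by [].
    by rewrite p0' in_fset0.
  rewrite p0' n0 in sb *; case: b sb bl {px l0} => [|[] [|? ?]] //= _ bl.
  by have := bl 0 isT.
have [|w /andP[rw /eqP wy]] := IH _ y _ py; first lia.
exists ((level x, m, c) :: w); rewrite /= rw wy (pncp_pdeg py) -xE eqxx andbT.
have [_] := compose_level rw; rewrite wy => <-.
by rewrite yx xn mc.
Qed.

Local Open Scope ring_scope.


(* The bilinear extension of - o_i -. *)
Definition compL (u : {freeg pol}) (i : nat) (v : {freeg pol}) : {freeg pol} :=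
  fglift (fun x => fglift (fun y => << pcomp x i y >> : {freeg pol}) v) u.

(* d psi_(m+1)^c *)
Definition d_psi (m : nat) (c : bool) : {freeg pol} :=
  << psi m (~~ c) >> + (-1) ^+ m *: << psi m c >>.

(* The boundary of a generator of positive degree, from its rightmost
   decomposition. A one-factor decomposition is (1, m, c), that of psi_m^c; one
   with more factors has [compose w'] of positive degree. The value 0 is only
   given to generators of degree 0, whose boundary is in [d_gen]. *)
Fixpoint d_dec (w : seq factor) : {freeg pol} :=
  match w with
  | [::] | [:: (_, 0%N, _)] => 0
  | [:: (_, m.+1, c)] => d_psi m c
  | (i, m, c) :: w' =>
      let x := compose w' in
      let k := pdeg x in
      if i == k.+1 then
        if m is m'.+1 then compL << x >> i (d_psi m' c) else - d_dec w'
      else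
        if m is m'.+1 then
          compL (d_dec w') i << psi m c >>
          + (-1) ^+ (k.+1 - i) *: compL << x >> i (d_psi m' c)
        else compL (d_dec w') i << psi 0 true >>
  end.

HB.instance Definition _ (R : nzRingType) (M : lmodType R) (K : choiceType) (f : K -> M) :=
  GRing.isZmodMorphism.Build {freeg K / R} M (fglift f) (lift_is_additive f).

(* The choice is irrelevant, by [compose_inj]. *)
Definition rightmost_decomposition n (x : NCP_F2 n) : seq factor :=
  xchoose (rightmost_exists (valP x)).

(* Reads a combination of degree n as an element of Z(NCP_F2(n)). Terms of any
   other degree would be dropped, but there are none where [lower] is used:
   see [d_dec_pncp] and [lowerK]. *)
Definition lower (n : nat) : {freeg pol} -> {freeg NCP_F2 n} :=
  fglift (fun x => if insub x is Some y then << y >> else 0 : {freeg NCP_F2 n}).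

(* The basis {s, t} of E_0 is coded by the booleans: s is false, t is true. *)
Definition E_grp (n : nat) : lmodType int :=
  if n is m.+1 then {freeg NCP_F2 m} else {freeg bool}.

Definition E_s : E_grp 0 := << false >> : {freeg bool}.
Definition E_t : E_grp 0 := << true >> : {freeg bool}.

Definition E_e : E_grp 0 -> int := fglift (fun _ : bool => 1%:Z : int^o).

Definition d_gen (n : nat) : NCP_F2 n -> E_grp n :=
  match n with
  | 0 => fun x => (-1) ^+ head false (val x).2 *: (E_t - E_s)
  | m.+1 => fun x => lower m (d_dec (rightmost_decomposition x))
  end.

Definition E_d (n : nat) : E_grp n.+1 -> E_grp n := fglift (@d_gen n).
Arguments E_d : clear implicits.
HB.instance Definition _ n := GRing.Additive.on (@E_d n).
HB.instance Definition _ := GRing.isZmodMorphism.Build (E_grp 0) int E_e (@lift_is_additive int bool int^o (fun=> 1%:Z)).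
HB.instance Definition _ n := GRing.Additive.on (@lower n).

Lemma fgliftU1 (K : choiceType) (M : lmodType int) (f : K -> M) x :
  fglift f << x >> = f x.
Proof. by rewrite liftU scale1r. Qed.

Lemma additiveZ (U V : lmodType int) (f : {additive U -> V}) (c : int) u :
  f (c *: u) = c *: f u.
Proof. by rewrite -[c]intz !scaler_int raddfMz. Qed.

Lemma freegUZ (K : choiceType) (c : int) (x : K) : << c *g x >> = c *: << x >> :> {freeg K}.
Proof. by apply/eqP/freeg_eqP => y; rewrite coeffZ !coeffU mul1r. Qed.

Lemma additive_freeg0 (K : choiceType) (M : lmodType int) (f : {additive {freeg K} -> M}) :
  (forall x, f << x >> = 0) -> forall u, f u = 0.
Proof.
move=> f0 u; rewrite -(freeg_sumE u) raddf_sum big1 // => x _.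
by rewrite freegUZ additiveZ f0 scaler0.
Qed.

Lemma additive_freeg_eq (K : choiceType) (M : lmodType int)
  (f g : {additive {freeg K} -> M}) : (forall x, f << x >> = g << x >>) -> f =1 g.
Proof.
move=> fg u; apply/eqP; rewrite -subr_eq0; apply/eqP.
by rewrite -(additive_freeg0 (f := f \- g) _ u) // => x; rewrite /= fg subrr.
Qed.

Lemma fglift_sum (K : choiceType) (M : lmodType int) (f : K -> M) u :
  fglift f u = \sum_(x <- dom u) coeff x u *: f x.
Proof.
by rewrite -{1}(freeg_sumE u) raddf_sum; apply: eq_bigr => x _; rewrite /= liftU.
Qed.

Lemma compLU x i y : compL << x >> i << y >> = << pcomp x i y >>.
Proof. by rewrite /compL !fgliftU1. Qed.

Lemma compLDl u v i z : compL (u + v) i z = compL u i z + compL v i z.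
Proof. exact: raddfD. Qed.
Lemma compL0l i z : compL 0 i z = 0.
Proof. exact: raddf0. Qed.
Lemma compLZl c u i z : compL (c *: u) i z = c *: compL u i z.
Proof. exact: additiveZ. Qed.
Lemma compLDr z i u v : compL z i (u + v) = compL z i u + compL z i v.
Proof.
rewrite /compL !fglift_sum -big_split; apply: eq_bigr => x _ /=.
by rewrite raddfD scalerDr.
Qed.
Lemma compLZr z i c u : compL z i (c *: u) = c *: compL z i u.
Proof.
rewrite /compL !fglift_sum scaler_sumr; apply: eq_bigr => x _ /=.
by rewrite additiveZ !scalerA mulrC.
Qed.

Definition spanned (n j : nat) (u : {freeg pol}) : Prop :=
  forall x, x \in dom u ->
  exists w, [/\ rightmost w, compose w = x, pdeg x = n & (last_index w < j)%N].

Lemma spanned0 n j : spanned n j 0.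
Proof. by move=> x; rewrite dom0. Qed.
Lemma spannedD n j u v : spanned n j u -> spanned n j v -> spanned n j (u + v).
Proof. by move=> su sv x /domD_subset; rewrite mem_cat => /orP[/su|/sv]. Qed.
Lemma spannedZ n j c u : spanned n j u -> spanned n j (c *: u).
Proof. by move=> su x /domZ_subset/su. Qed.
Lemma spannedN n j u : spanned n j u -> spanned n j (- u).
Proof. by rewrite -scaleN1r; apply: spannedZ. Qed.
Lemma spannedU n j w : rightmost w -> pdeg (compose w) = n -> (last_index w < j)%N ->
  spanned n j << compose w >>.
Proof. by move=> rw dw lw x; rewrite domU1 mem_seq1 => /eqP ->; exists w. Qed.
Lemma spanned_le n j j' u : (j <= j')%N -> spanned n j u -> spanned n j' u.
Proof.
move=> jj su x /su[w [? ? ? lw]]; exists w; split => //; exact: leq_trans lw jj.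
Qed.

Lemma spanned_ind (P : {freeg pol} -> Prop) n j : P 0 ->
  (forall c w u, rightmost w -> pdeg (compose w) = n -> (last_index w < j)%N ->
     P u -> P (c *: << compose w >> + u)) ->
  forall u, spanned n j u -> P u.
Proof.
move=> P0 PS u su; rewrite -(freeg_sumE u).
have : all (mem (dom u)) (dom u) by apply/allP.
elim: {-1}(dom u) => [|x s IH] /=; first by rewrite big_nil.
case/andP=> xu /IH {}IH; rewrite big_cons.
have [w [rw wx dx lw]] := su x xu; rewrite freegUZ -wx; apply: PS => //.
by rewrite wx.
Qed.

Lemma d_dec_cons i m c w : w != [::] ->
  d_dec ((i, m, c) :: w) =
  (if i == (pdeg (compose w)).+1 then
     if m is m'.+1 then compL << compose w >> i (d_psi m' c) else - d_dec w
   else if m is m'.+1 then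
     compL (d_dec w) i << psi m c >>
     + (-1) ^+ ((pdeg (compose w)).+1 - i) *: compL << compose w >> i (d_psi m' c)
   else compL (d_dec w) i << psi 0 true >>).
Proof. by case: w m => [|f w] [|m]. Qed.

Lemma rightmost_cons i m c w : rightmost ((i, m, c) :: w) =
  [&& rightmost w, last_index w < i, i <= (pdeg (compose w)).+1 & (0 < m) || c]%N.
Proof. by []. Qed.

Lemma rightmost_inv i m c w : rightmost ((i, m, c) :: w) ->
  [/\ rightmost w, last_index w < i, i <= (pdeg (compose w)).+1 & (0 < m) || c]%N.
Proof. by rewrite rightmost_cons => /and4P. Qed.

Lemma pdeg_cons i m c w : rightmost ((i, m, c) :: w) ->
  pdeg (compose ((i, m, c) :: w)) = (pdeg (compose w) + m)%N.
Proof.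
case/rightmost_inv=> /compose_level[pw _] wi iw _.
apply: pncp_pdeg; apply: pcomp_pncp => //; last exact: psi_pncp.
by rewrite iw (leq_ltn_trans _ wi).
Qed.

Lemma last_index_gt0 w : rightmost w -> w != [::] -> (0 < last_index w)%N.
Proof. by case: w => [|[[i m] c] w] // /rightmost_inv[_ /(leq_ltn_trans (leq0n _))]. Qed.

Lemma pdeg_gt0 i m c w : rightmost ((i, m, c) :: w) -> w != [::] ->
  (0 < pdeg (compose w))%N.
Proof.
case/rightmost_inv=> rw wi iw _ w0; have := last_index_gt0 rw w0; lia.
Qed.

Lemma rightmost_head i m c e l w : rightmost ((i, m, c) :: w) -> (0 < l)%N || e ->
  rightmost ((i, l, e) :: w).
Proof. by case/rightmost_inv=> rw wi iw _ le; rewrite rightmost_cons rw wi iw. Qed.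

Lemma spanned_comp_psi i m c l e w n : rightmost ((i, m, c) :: w) ->
  (pdeg (compose w) + l = n)%N ->
  spanned n i.+1 << pcomp (compose w) i (psi l e) >>.
Proof.
move=> rw dw; have [le|] := boolP ((0 < l)%N || e).
  have rw' := rightmost_head rw le.
  have -> : pcomp (compose w) i (psi l e) = compose ((i, l, e) :: w) by [].
  by apply: spannedU => //; rewrite pdeg_cons.
case: l e dw => [|//] [//|] dw _; rewrite addn0 in dw.
case/rightmost_inv: rw => rw wi iw _; have [pw _] := compose_level rw.
rewrite psi0_r; first by apply: spannedU => //; apply: ltnW.
by rewrite (pncp_size pw) iw (leq_ltn_trans _ wi).
Qed.

Lemma spanned_comp_d_psi i m c l e w n : rightmost ((i, m, c) :: w) ->
  (pdeg (compose w) + l = n)%N ->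
  spanned n i.+1 (compL << compose w >> i (d_psi l e)).
Proof.
move=> rw dw; rewrite /d_psi compLDr compLZr !compLU.
by apply: spannedD; [|apply: spannedZ]; apply: (spanned_comp_psi rw dw).
Qed.

Lemma psi_pcomp m c : psi m c = pcomp (psi 0 false) 1 (psi m c).
Proof.
rewrite [LHS]surjective_pairing [RHS]surjective_pairing; congr (_, _).
  have sE (A : {fset nat}) : [fset shift 1 1.-1 x | x in A] = A.
    apply/fsetP => x; apply/imfsetP/idP => [[y /= yA ->]|xA].
      by rewrite /shift addn0 if_same.
    by exists x; rewrite //= /shift addn0 if_same.
  apply/fsetP => C; apply/idP/ncp_compP => [Cp|]; first by right; exists C; rewrite ?sE.
  by case=> -[A Ap ->]; [rewrite /= in_fset0 in Ap|rewrite sE].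
by rewrite /= map_id_in ?cats0 // => -[] //.
Qed.

Lemma spanned_d_dec w n : rightmost w -> pdeg (compose w) = n.+1 ->
  spanned n (last_index w).+1 (d_dec w).
Proof.
elim: w n => [|[[i m] c] w IH] n rw; first by move=> _; apply: spanned0.
have [w0|w0] := eqVneq w [::].
  subst w; rewrite pdeg_cons // add0n => mn; subst m.
  have i1 : i = 1 by move: rw => /rightmost_inv[_]; rewrite /pdeg /=; lia.
  subst i; rewrite /= /d_psi [psi n _ in X in << X >>]psi_pcomp.
  rewrite [psi n c]psi_pcomp.
  by apply: spannedD; [|apply: spannedZ]; apply: (spanned_comp_psi (w := [::]) rw).
have k0 := pdeg_gt0 rw w0; rewrite d_dec_cons // pdeg_cons //=.
case/rightmost_inv: (rw) => rw' wi iw mc; case k: (pdeg (compose w)) k0 iw => [//|k'] _ iw.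
have {}IH := IH k' rw' k; case: eqP => [ik|/eqP ik].
  case: m rw mc => [|m] rw mc kn.
    have -> : n = k' by lia.
    by apply: spannedN; apply: spanned_le IH; lia.
  by apply: (spanned_comp_d_psi rw); lia.
have [P1 P2] : (k' + m = n -> spanned n i.+1 (compL (d_dec w) i << psi m c >>))%N /\ True.
  split => // kn; elim/spanned_ind: (d_dec w) / IH => [|e v u rv dv lv su].
    by rewrite compL0l; apply: spanned0.
  rewrite compLDl compLZl compLU; apply: spannedD => //; apply: spannedZ.
  by apply: (@spanned_comp_psi i m c) => //; rewrite ?rightmost_cons ?dv // rv mc; lia.
case: m mc rw P1 => [|m] mc rw P1 kn.
  by case: c mc {rw} P1 => // _; apply; lia.
apply: spannedD; first by apply: P1; lia.
by apply: spannedZ; apply: (spanned_comp_d_psi rw); lia.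
Qed.

Definition d_raw (n : nat) : {freeg pol} -> {freeg pol} :=
  fglift (fun x => if insub x is Some y
                   then d_dec (@rightmost_decomposition n y) else 0 : {freeg pol}).
HB.instance Definition _ n := GRing.Additive.on (@d_raw n).

Lemma d_raw0 n : d_raw n 0 = 0. Proof. exact: raddf0. Qed.
Lemma d_rawD n u v : d_raw n (u + v) = d_raw n u + d_raw n v.
Proof. exact: raddfD. Qed.
Lemma d_rawN n u : d_raw n (- u) = - d_raw n u.
Proof. exact: raddfN. Qed.
Lemma d_rawZ n c u : d_raw n (c *: u) = c *: d_raw n u.
Proof. exact: additiveZ. Qed.

Lemma rightmost_decompositionE n (x : NCP_F2 n) w :
  rightmost w -> compose w = val x -> rightmost_decomposition x = w.
Proof.
move=> rw wx; rewrite /rightmost_decomposition.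
have /andP[rv /eqP vx] := xchooseP (rightmost_exists (valP x)).
by apply: compose_inj => //; rewrite vx.
Qed.

Lemma d_rawE n w : rightmost w -> pdeg (compose w) = n ->
  d_raw n << compose w >> = d_dec w.
Proof.
move=> rw dw; rewrite /d_raw fgliftU1.
have pw : is_pncp n (compose w) by have [] := compose_level rw; rewrite dw.
by rewrite insubT (@rightmost_decompositionE _ _ w).
Qed.

Lemma d_raw_comp k j i m c z : (j <= i)%N -> (1 < i)%N -> (0 < m)%N || c -> (i <= k.+2)%N ->
  spanned k.+1 j z ->
  d_raw (k.+1 + m) (compL z i << psi m c >>) =
   (if i == k.+2 then
     if m is m'.+1 then compL z i (d_psi m' c) else - d_raw k.+1 z
   else if m is m'.+1 then
     compL (d_raw k.+1 z) i << psi m c >>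
     + (-1) ^+ (k.+2 - i) *: compL z i (d_psi m' c)
   else compL (d_raw k.+1 z) i << psi 0 true >>).
Proof.
move=> ji i1 mc ik sz; elim/spanned_ind: z / sz => [|e v u rv dv lv IH].
  by rewrite !(compL0l, d_raw0); case: ifP => _; case: m {mc} => *; rewrite ?compL0l ?oppr0 ?scaler0 ?addr0.
have v0 : v != [::] by case: v dv {rv lv}.
have rm : rightmost ((i, m, c) :: v) by rewrite rightmost_cons rv dv mc; lia.
rewrite compLDl compLZl compLU d_rawD d_rawZ IH.
have -> : pcomp (compose v) i (psi m c) = compose ((i, m, c) :: v) by [].
rewrite d_rawE ?pdeg_cons ?dv // d_dec_cons // dv d_rawD d_rawZ d_rawE //.
case: ifP => _; case: m {mc rm IH} => [|m].
- by rewrite scalerN opprD.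
- by rewrite compLDl compLZl.
- by rewrite compLDl compLZl.
- by rewrite !compLDl !compLZl !scalerDr !addrA ![_ *: (_ *: _)]scalerA [e * _]mulrC -!addrA; congr (_ + _); rewrite addrCA.
Qed.

Lemma d_dec_psi m c : d_raw m.+1 << psi m.+1 c >> = d_psi m c.
Proof.
have rw : rightmost [:: (1, m.+1, c)] by [].
have -> : psi m.+1 c = compose [:: (1, m.+1, c)] by rewrite {1}psi_pcomp.
by rewrite d_rawE // pdeg_cons.
Qed.

Lemma signK (V : lmodType int) n (u : V) : (-1) ^+ n *: ((-1) ^+ n *: u) = u.
Proof. by rewrite scalerA -exprMn mulrNN mulr1 expr1n scale1r. Qed.

Lemma d_raw_d_psi m c : d_raw m.+1 (d_psi m.+1 c) = 0.
Proof.
rewrite {1}/d_psi d_rawD d_rawZ !d_dec_psi /d_psi negbK.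
by rewrite exprS mulN1r scaleNr scalerDr signK opprD addrA addrK subrr.
Qed.

Lemma d_dec_d_dec w n : rightmost w -> pdeg (compose w) = n.+2 ->
  d_raw n.+1 (d_dec w) = 0.
Proof.
elim: w n => [|[[i m] c] w IH] n rw; first by move=> _; apply: d_raw0.
have [w0|w0] := eqVneq w [::].
  subst w; rewrite pdeg_cons // add0n => mn; subst m; exact: d_raw_d_psi.
have k0 := pdeg_gt0 rw w0; rewrite d_dec_cons // pdeg_cons //=.
case/rightmost_inv: (rw) => rw' wi iw mc; have l0 := last_index_gt0 rw' w0.
case k: (pdeg (compose w)) k0 iw => [//|k'] _ iw.
have sw : spanned k'.+1 i << compose w >> by apply: spannedU.
have wE : pcomp (compose w) i (psi 0 false) = compose w.
  apply: psi0_r; have [pw _] := compose_level rw'.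
  by rewrite (pncp_size pw) k; lia.
have dd m' : (k' + m'.+1 = n.+1)%N ->
    d_raw n.+1 (compL << compose w >> i (d_psi m' c)) =
    if i == k'.+2 then 0 else compL (d_dec w) i (d_psi m' c).
  move=> kn; rewrite /d_psi compLDr compLZr d_rawD d_rawZ.
  have {kn} -> : n.+1 = (k'.+1 + m')%N by lia.
  case: m' => [|m'].
    rewrite expr0 scale1r addrC.
    have : d_raw (k'.+1 + 0) (compL << compose w >> i << psi 0 false >>) = d_dec w.
      by rewrite compLU wE d_rawE ?k ?addn0.
    have : d_raw (k'.+1 + 0) (compL << compose w >> i << psi 0 true >>) =
       if i == k'.+2 then - d_dec w else compL (d_dec w) i << psi 0 true >>.
      by rewrite (@d_raw_comp _ i) ?d_rawE //; lia.
    have : compL (d_dec w) i << psi 0 false >> = d_dec w \/ i = k'.+2.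
      have [->|ik] := eqVneq i k'.+2; [by right|left].
      elim/spanned_ind: (d_dec w) / (spanned_d_dec rw' k) => [|e v u rv dv lv IHu].
        exact: compL0l.
      rewrite compLDl compLZl compLU IHu psi0_r //.
      by have [pv _] := compose_level rv; rewrite (pncp_size pv) dv; lia.
    rewrite compLDr; case: (c) => /=.
      by case: eqP => [_ _|_ [->|//]] -> ->; rewrite !scale1r ?addrN ?addNr // addrC.
    by case: eqP => [_ _|_ [->|//]] -> ->; rewrite !scale1r ?addrN ?addNr // addrC.
  rewrite !(@d_raw_comp _ i) ?d_rawE //; try lia.
  have d2 u : compL u i (d_psi m' (~~ c)) + (-1) ^+ m'.+1 *: compL u i (d_psi m' c) = 0.
    rewrite -compLZr -compLDr.
    have := d_raw_d_psi m' c.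
    rewrite /(d_psi m'.+1) d_rawD d_rawZ !d_dec_psi => ->.
    by rewrite /compL fglift_sum big1 // => x _; rewrite raddf0 scaler0.
  case: ifP => _; first exact: d2.
  rewrite scalerDr addrACA scalerA mulrC -scalerA -scalerDr d2 scaler0 addr0.
  by rewrite compLDr compLZr.
case: eqP => [ik|/eqP ik].
  case: m rw mc => [|m] rw mc kn.
    by rewrite d_rawN IH ?oppr0 //; lia.
  by rewrite dd ?ik ?eqxx //; lia.
have sdw := spanned_d_dec rw' k.
case: k' => [|k'] in k iw sw wE dd ik sdw *; first lia.
have ddw : d_raw k'.+1 (d_dec w) = 0 by apply: IH.
case: m rw mc => [|m] rw mc kn.
  case: c mc {rw dd} => // _; have -> : n.+1 = (k'.+1 + 0)%N by lia.
  rewrite (@d_raw_comp _ (last_index w).+1) //; try lia.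
  by rewrite ddw compL0l oppr0 if_same.
rewrite d_rawD d_rawZ dd; last lia.
rewrite (negbTE ik); have -> : n.+1 = (k'.+1 + m.+1)%N by lia.
rewrite (@d_raw_comp _ (last_index w).+1) //; try lia.
rewrite ddw compL0l add0r; case: eqP => [->|ik'].
  by rewrite subSn // subnn expr1 scaleN1r addrN.
have -> : (k'.+3 - i = (k'.+2 - i).+1)%N by lia.
by rewrite exprS mulN1r scaleNr addrN.
Qed.

Lemma d_dec_pncp n w : rightmost w -> pdeg (compose w) = n.+1 ->
  forall x, x \in dom (d_dec w) -> is_pncp n x.
Proof.
move=> rw dw x /(spanned_d_dec rw dw)[v [rv <- dv _]].
by have [] := compose_level rv; rewrite dv.
Qed.

Lemma lowerK n (u : {freeg pol}) : (forall x, x \in dom u -> is_pncp n x) ->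
  fglift (fun y : NCP_F2 n => << val y >> : {freeg pol}) (lower n u) = u.
Proof.
move=> un; rewrite /lower [X in fglift _ X]fglift_sum raddf_sum -[RHS]freeg_sumE /=.
apply: eq_big_seq => x /un px. rewrite additiveZ. rewrite insubT /= fgliftU1 /=.
by rewrite [RHS]freegUZ.
Qed.

Lemma lowerU n x (px : is_pncp n x) : lower n << x >> = << NCP_F2_of px >>.
Proof. by rewrite /lower fgliftU1 insubT. Qed.

Lemma E_d_lower n u : E_d n.+1 (lower n.+1 u) = lower n (d_raw n.+1 u).
Proof.
apply: (additive_freeg_eq (f := E_d n.+1 \o lower n.+1) (g := lower n \o d_raw n.+1)).
move=> x /=; rewrite /lower /d_raw !fgliftU1; case: insubP => [y _ yx|_]; last by rewrite !raddf0.
by rewrite /E_d fgliftU1.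
Qed.

Lemma d_dec1 w : rightmost w -> pdeg (compose w) = 1 ->
  exists e : int, d_dec w = e *: (<< psi 0 false >> + << psi 0 true >>).
Proof.
elim: w => // [[[i m] c] w] IH rw; have [w0|w0] := eqVneq w [::].
  subst w; rewrite pdeg_cons // add0n => mn; subst m; exists 1.
  by rewrite /= /d_psi expr0 !scale1r; case: (c); rewrite //= addrC.
have k0 := pdeg_gt0 rw w0; rewrite d_dec_cons // pdeg_cons //=.
case/rightmost_inv: (rw) => rw' wi iw mc; have l0 := last_index_gt0 rw' w0 => km.
have k1 : pdeg (compose w) = 1 by lia.
have m0 : m = 0 by lia.
have [e eE] := IH rw' k1; exists (- e); have -> : i = 2 by lia.
by rewrite k1 m0 /= eE scaleNr.
Qed.

Lemma E_dd n u : E_d n (E_d n.+1 u) = 0.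
Proof.
apply: (@additive_freeg0 (NCP_F2 n.+1) (E_grp n) (E_d n \o E_d n.+1)) => x /=; rewrite /E_d fgliftU1 -/(E_d n) /=.
have /andP[rw /eqP wx] := xchooseP (rightmost_exists (valP x)).
rewrite -/(rightmost_decomposition x) in rw wx.
have dw : pdeg (compose (rightmost_decomposition x)) = n.+1.
  by rewrite wx; apply: pncp_pdeg; apply: valP.
case: n => [|n] in u x rw wx dw *; last first.
  by rewrite E_d_lower d_dec_d_dec // raddf0.
have [e ->] := d_dec1 rw dw; rewrite [lower _ _]additiveZ [E_d _ _]additiveZ.
rewrite raddfD /= !(lowerU (psi_pncp 0 _)) raddfD /= /E_d !fgliftU1 /=.
by rewrite expr0 expr1 scaleN1r scale1r addrN scaler0.
Qed.

Lemma E_ed u : E_e (E_d 0 u) = 0.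
Proof.
apply: (@additive_freeg0 (NCP_F2 0) int^o (E_e \o E_d 0)) => x /=; rewrite /E_d fgliftU1 /=.
rewrite (@additiveZ _ int^o (GRing.Additive.clone _ _ E_e _)) /= raddfB /=.
by rewrite /E_e !fgliftU1 subrr scaler0.
Qed.

Record aug_complex := AugComplex {
  ac_grp :> nat -> zmodType;
  ac_d : forall n, {additive ac_grp n.+1 -> ac_grp n};
  ac_e : {additive ac_grp 0 -> int};
  ac_dd : forall n x, ac_d n (ac_d n.+1 x) = 0;
  ac_ed : forall x, ac_e (ac_d 0 x) = 0
}.

Record ac_hom (C D : aug_complex) := AcHom {
  hom_fun :> forall n, {additive C n -> D n};
  hom_d : forall n x, hom_fun n (ac_d C n x) = ac_d D n (hom_fun n.+1 x);
  hom_e : forall x, ac_e D (hom_fun 0 x) = ac_e C x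
}.

Definition E : aug_complex :=
  @AugComplex E_grp (fun n => @E_d n) E_e E_dd E_ed.

Record subgroup (V : zmodType) (S : zmodClosed V) :=
  Subgroup { subgroup_val :> V; _ : subgroup_val \in S }.
HB.instance Definition _ V S := [isSub for @subgroup_val V S].
HB.instance Definition _ V S := [Choice of @subgroup V S by <:].
HB.instance Definition _ V S := [SubChoice_isSubZmodule of @subgroup V S by <:].

Definition is_subcomplex (C : aug_complex) (S : forall n, zmodClosed (C n)) : Prop :=
  forall n (x : C n.+1), x \in S n.+1 -> ac_d C n x \in S n.

Section Subcomplex.

Variables (C : aug_complex) (S : forall n, zmodClosed (C n)).
Hypothesis subS : is_subcomplex S.

Definition subcomplex_d n (x : subgroup (S n.+1)) : subgroup (S n) :=
  Subgroup (subS (valP x)).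

Lemma subcomplex_d_additive n : zmod_morphism (@subcomplex_d n).
Proof. by move=> x y; apply: val_inj; rewrite /= !raddfB. Qed.
HB.instance Definition _ n :=
  GRing.isZmodMorphism.Build _ _ (@subcomplex_d n) (@subcomplex_d_additive n).

Definition subcomplex_e (x : subgroup (S 0)) : int := ac_e C (val x).

Lemma subcomplex_e_additive : zmod_morphism subcomplex_e.
Proof. by move=> x y; rewrite /subcomplex_e !raddfB. Qed.
HB.instance Definition _ :=
  GRing.isZmodMorphism.Build _ _ subcomplex_e subcomplex_e_additive.

Lemma subcomplex_dd n x : @subcomplex_d n (subcomplex_d x) = 0.
Proof. apply: val_inj; apply: etrans (ac_dd _) _; exact: esym (raddf0 _). Qed.

Lemma subcomplex_ed x : subcomplex_e (subcomplex_d x) = 0.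
Proof. exact: ac_ed. Qed.

Definition subcomplex : aug_complex :=
  @AugComplex (fun n => subgroup (S n)) (fun n => @subcomplex_d n) subcomplex_e
    subcomplex_dd subcomplex_ed.

Definition subcomplex_hom : ac_hom subcomplex C :=
  @AcHom subcomplex C (fun n => (val : {additive subgroup (S n) -> C n}))
    (fun n x => erefl) (fun x => erefl).

End Subcomplex.

Section SubcomplexIncl.

Variables (C : aug_complex) (S T : forall n, zmodClosed (C n)).
Hypotheses (subS : is_subcomplex S) (subT : is_subcomplex T).
Hypothesis leST : forall n, {subset S n <= T n}.

Definition subgroup_incl n (x : subgroup (S n)) : subgroup (T n) :=
  Subgroup (leST (valP x)).

Lemma subgroup_incl_additive n : zmod_morphism (@subgroup_incl n).
Proof. by move=> x y; apply: val_inj. Qed.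
HB.instance Definition _ n :=
  GRing.isZmodMorphism.Build _ _ (@subgroup_incl n) (@subgroup_incl_additive n).

Lemma subgroup_incl_d n (x : subcomplex subS n.+1) :
  subgroup_incl (ac_d (subcomplex subS) n x) = ac_d (subcomplex subT) n (subgroup_incl x).
Proof. exact: val_inj. Qed.

Definition subcomplex_incl : ac_hom (subcomplex subS) (subcomplex subT) :=
  @AcHom (subcomplex subS) (subcomplex subT) (fun n => @subgroup_incl n)
    subgroup_incl_d (fun x => erefl).

End SubcomplexIncl.

(* As a subgroup of E_(n+1), the group generated by the elements of level at most
   k consists of the combinations supported on them. *)
Definition E_level_pred (k n : nat) : {pred E n} :=
  match n return {pred E n} with
  | 0 => predT
  | m.+1 => fun u : {freeg NCP_F2 m} => all (fun x : NCP_F2 m => level x <= k)%N (dom u)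
  end.
Arguments E_level_pred : clear implicits.

Lemma E_level_closed k n : zmod_closed (E_level_pred k n).
Proof.
case: n => [|n]; split=> // [|u v]; rewrite /in_mem /=; first by rewrite dom0.
move=> /allP uk /allP vk; apply/allP => x /domB.
by rewrite mem_cat => /orP[/uk|/vk].
Qed.
HB.instance Definition _ k n :=
  GRing.isZmodClosed.Build (E n) (E_level_pred k n) (E_level_closed k n).

Definition E_level (k n : nat) : zmodClosed (E n) := E_level_pred k n.

Lemma E_level_le k n : {subset E_level k n <= E_level k.+1 n}.
Proof.
case: n => [|n] u; first by [].
rewrite /in_mem /= => /allP uk; apply/allP => x /uk; exact: leqW.
Qed.

Definition is_filtration (F : nat -> aug_complex)
    (j : forall k, ac_hom (F k) (F k.+1)) : Prop :=
  forall k n, injective (j k n).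

(* Universal property, in the category of augmented chain complexes, of the
   cocone i on the sequence F 0 -> F 1 -> ... with transition maps j. *)
Definition is_colimit (F : nat -> aug_complex)
    (j : forall k, ac_hom (F k) (F k.+1))
    (L : aug_complex) (i : forall k, ac_hom (F k) L) : Prop :=
  (forall k n x, i k.+1 n (j k n x) = i k n x) /\
  forall (D : aug_complex) (f : forall k, ac_hom (F k) D),
    (forall k n x, f k.+1 n (j k n x) = f k n x) ->
    exists g : ac_hom L D,
      (forall k n x, g n (i k n x) = f k n x) /\
      forall h : ac_hom L D, (forall k n x, h n (i k n x) = f k n x) ->
        forall n x, h n x = g n x.

(* Main.v *)
Require Import Defs.
From mathcomp Require Import all_boot.
From HB Require Import structures.
From mathcomp Require Import ssralg ssrint freeg.

(** The differential never raises the level.  The level of a polarised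
    noncrossing partition is the last index of its rightmost decomposition
    ([compose_level]), and the differential of a generator is computed from
    that decomposition by operations that create no factor beyond its last
    index: the final factor [psi_m^c] at position [i] is either kept, replaced
    by the terms of [d psi_m^c] at the same position [i], or dropped, while the
    remaining factors, all at smaller positions, are differentiated recursively
    ([spanned_d_dec]).  So every generator occurring in [d x] has level at most
    that of [x], which is [E_level_subcomplex].

    The rest holds for any increasing chain of subcomplexes of an augmented
    chain complex: inclusions are injective, and if every element lies in some
    stage, then the whole complex is the colimit ([exhaustive_colimit]).  A
    compatible family of morphisms out of the stages takes one value on each
    element, whichever stage is used to evaluate it, and any two elements lie
    in a common stage, so these values form a morphism.  A combination of
    generators lies in the stage of the largest level of its terms, so the level
    filtration exhausts [E]. *)

Set Implicit Arguments.
Unset Strict Implicit.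
Unset Printing Implicit Defensive.

Import GRing.Theory.
Local Open Scope nat_scope.

Lemma dom_lower n (u : {freeg pol}) (y : NCP_F2 n) :
  y \in dom (lower n u) -> val y \in dom u.
Proof.
rewrite !mem_dom; apply: contraNN => /eqP uy; apply/eqP.
rewrite /lower fglift_sum raddf_sum big1_seq //= => x xu.
rewrite coeffZ; case: insubP => [z _ zx|_]; last by rewrite coeff0 mulr0.
rewrite coeffU mul1r; case: eqP => [zy|_]; last by rewrite mulr0.
by rewrite -zx zy uy mul0r.
Qed.

(** The index bound of [spanned_d_dec] is a level bound, since the last index
    of a rightmost decomposition is the level of its composite. *)
Lemma d_gen_level k n (x : NCP_F2 n) : level x <= k -> d_gen x \in E_level k n.
Proof.
case: n x => [//|n] x xk; rewrite /in_mem /=; apply/allP => y /dom_lower yd.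
have /andP[rw /eqP wx] := xchooseP (rightmost_exists (valP x)).
rewrite -/(rightmost_decomposition x) in rw wx.
have dw : pdeg (compose (rightmost_decomposition x)) = n.+1.
  by rewrite wx; apply: pncp_pdeg; apply: valP.
have [v [rv vy _ lv]] := spanned_d_dec rw dw yd.
rewrite -[pncp_val y]vy (compose_level rv).2.
apply: leq_trans xk; rewrite -ltnS; apply: leq_trans lv _.
by rewrite -(compose_level rw).2 wx.
Qed.

Lemma E_level_subcomplex k : @is_subcomplex E (E_level k).
Proof.
move=> n u uk; rewrite /= /E_d fglift_sum big_seq.
apply: (@rpred_sum _ (E_level k n)) => x xu.
rewrite -[coeff x u]intz scaler_int; apply: (@rpredMz _ (E_level k n)).
by apply: d_gen_level; move/allP: uk; apply.
Qed.

Lemma E_level_exhaustive n (u : E n) : exists k, u \in E_level k n.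
Proof.
case: n u => [|n] u; first by exists 0.
exists (\max_(x <- dom (u : {freeg NCP_F2 n})) level x).
rewrite /in_mem /=; apply/allP => x xu.
exact: (@leq_bigmax_seq _ (dom (u : {freeg NCP_F2 n})) xpredT (fun x : NCP_F2 n => level x)).
Qed.

Section ExhaustiveFiltration.

Variables (C : aug_complex) (S : nat -> forall n, zmodClosed (C n)).
Hypothesis subS : forall k, is_subcomplex (S k).
Hypothesis leS : forall k n, {subset S k n <= S k.+1 n}.

Let j k := subcomplex_incl (@subS k) (@subS k.+1) (@leS k).

Lemma subcomplex_filtration : is_filtration j.
Proof. by move=> k n x y /(congr1 val) /= xy; apply: val_inj. Qed.

Hypothesis exS : forall n (x : C n), exists k, x \in S k n.

Lemma stage_le k l n : k <= l -> {subset S k n <= S l n}.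
Proof.
elim: l => [|l IH]; first by rewrite leqn0 => /eqP ->.
by rewrite leq_eqVlt => /predU1P[->//|/IH kl] x /kl; apply: leS.
Qed.

Definition stage n (x : C n) : nat := ex_minn (exS x).

Lemma stageP n (x : C n) : x \in S (stage x) n.
Proof. by rewrite /stage; case: ex_minnP. Qed.

Section Glue.

Variables (D : aug_complex) (f : forall k, ac_hom (subcomplex (@subS k)) D).
Hypothesis fj : forall k n x, f k.+1 n (j k n x) = f k n x.

(** Makes the glued map independent of the stage, so that [glueE] can evaluate
    it at whichever stage suits the operation at hand. *)
Lemma cocone_stage k l n (x : C n) (xk : x \in S k n) (xl : x \in S l n) :
  f k n (Subgroup xk) = f l n (Subgroup xl).
Proof.
wlog kl : k l xk xl / k <= l.
  by move=> H; case/orP: (leq_total k l) => ?; [|symmetry]; apply: H.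
elim: l kl xl => [|l IH].
  by rewrite leqn0 => /eqP k0; subst k => xl; congr (f 0 n _); apply: val_inj.
rewrite leq_eqVlt => /predU1P[kl|kl] xl.
  by subst k; congr (f l.+1 n _); apply: val_inj.
rewrite (IH kl (@stage_le k l n kl x xk)) -fj; congr (f l.+1 n _); exact: val_inj.
Qed.

Definition glue n (x : C n) : D n := f (stage x) n (Subgroup (stageP x)).

Lemma glueE k n (x : C n) (xk : x \in S k n) : glue x = f k n (Subgroup xk).
Proof. exact: cocone_stage. Qed.

Lemma glue_zmod_morphism n : zmod_morphism (@glue n).
Proof.
move=> x y; have [[k xk] [l yl]] := (exS x, exS y).
(* Both elements are moved to a common stage, where [f] is additive. *)
have xm := stage_le (leq_maxl k l) xk; have ym := stage_le (leq_maxr k l) yl.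
rewrite (glueE xm) (glueE ym) (glueE (rpredB xm ym)) -raddfB.
by congr (f _ n _); apply: val_inj.
Qed.

HB.instance Definition _ n :=
  GRing.isZmodMorphism.Build _ _ (@glue n) (@glue_zmod_morphism n).

Lemma glue_d n (x : C n.+1) : glue (ac_d C n x) = ac_d D n (glue x).
Proof.
have [k xk] := exS x; rewrite (glueE xk) (glueE (subS xk)) -hom_d.
by congr (f k n _); apply: val_inj.
Qed.

Lemma glue_e (x : C 0) : ac_e D (glue x) = ac_e C x.
Proof. by have [k xk] := exS x; rewrite (glueE xk) hom_e. Qed.

Definition glue_hom : ac_hom C D :=
  @AcHom C D (fun n => @glue n) glue_d glue_e.

End Glue.

Lemma exhaustive_colimit : is_colimit j (fun k => subcomplex_hom (@subS k)).
Proof.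
split=> // D f fj; exists (glue_hom fj); split=> [k n [x xk]|h hf n x].
  exact: glueE.
have [k xk] := exS x; rewrite [RHS](glueE fj xk); exact: (hf k n (Subgroup xk)).
Qed.

End ExhaustiveFiltration.

Theorem proposition2p8 :
  exists subE : forall k : nat, @is_subcomplex E (E_level k),
    is_filtration
      (fun k => subcomplex_incl (subE k) (subE k.+1) (@E_level_le k)) /\
    is_colimit
      (fun k => subcomplex_incl (subE k) (subE k.+1) (@E_level_le k))
      (fun k => subcomplex_hom (subE k)).
Proof.
exists E_level_subcomplex; split; first exact: subcomplex_filtration.
exact/exhaustive_colimit/E_level_exhaustive.
Qed.
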